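(* Let $\mathcal{X}$ be a real Banach space, $\mathcal{C}\subset\mathcal{X}$ a closed pointed convex normal cone with nonempty interior $\mathcal{C}^0$. Let $U\subset\mathcal{C}^0$ be a convex open set such that $tU\subset U$ for all $t>0$. Let $f:U\to\mathcal{C}^0$ be a continuously differentiable map such that $\omega(f(x)/f(y))=0$ whenever $x,y\in U$ and $\omega(x/y)=0$. Then $$\sup_{\substack{x,y\in U\\ d_H(x,y)\neq0}}\frac{d_H(f(x),f(y))}{d_H(x,y)}=\sup_{x\in U}\ \sup_{\nu,\pi\in\operatorname{extr}\mathcal{P}(f(x))}\ \sup_{z\in[0,x]}\langle\nu-\pi,Df(x)z\rangle .$$
   Context: Pointed convex cone: $\alpha\mathcal{C}\subset\mathcal{C}$ for $\alpha\ge0$, $\mathcal{C}+\mathcal{C}\subset\mathcal{C}$, $\mathcal{C}\cap(-\mathcal{C})=\{0\}$. Order: $x\le y$ iff $y-x\in\mathcal{C}$; $[x,y]=\{z:x\le z\le y\}$. Normal: there is $K>0$ with $0\le x\le y\Rightarrow\|x\|\le K\|y\|$. For $x\in\mathcal{X}$, $y\in\mathcal{C}^0$: $M(x/y)=\inf\{t\in\mathbb{R}:x\le ty\}$, $m(x/y)=\sup\{t\in\mathbb{R}:x\ge ty\}$, $\omega(x/y)=M(x/y)-m(x/y)$. Hilbert's projective metric on $\mathcal{C}^0$: $d_H(x,y)=\log\big(M(x/y)/m(x/y)\big)$. Dual cone $\mathcal{C}^\star=\{\mu\in\mathcal{X}^\star:\langle\mu,x\rangle\ge0\ \forall x\in\mathcal{C}\}$;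 for $y\in\mathcal{C}^0$, $\mathcal{P}(y)=\{\mu\in\mathcal{C}^\star:\langle\mu,y\rangle=1\}$, and $\operatorname{extr}$ denotes its extreme points. $Df(x)$ is the derivative of $f$ at $x$. The supremum on the left is $0$ if it is over the empty set (which happens only if $\dim\mathcal{X}=1$ or $U=\emptyset$; $U$ is understood to be nonempty). *)

(* Defs.v *)
From HB Require Import structures.
From mathcomp Require Export all_boot all_order all_algebra.
From mathcomp Require Export all_classical all_reals all_analysis.
Export Order.TTheory GRing.Theory Num.Theory.
Export numFieldNormedType.Exports.

#[export] Set Implicit Arguments.
#[export] Unset Strict Implicit.
#[export] Unset Printing Implicit Defensive.

Local Open Scope classical_set_scope.
Local Open Scope ring_scope.

Section Cones.
Context {R : realType} {X : normedModType R}.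
Implicit Types (C : set X) (x y z : X).

Definition pointed_convex_cone C : Prop :=
  [/\ forall a : R, 0 <= a -> [set a *: x | x in C] `<=` C,
      [set x + y | x in C & y in C] `<=` C
    & C `&` [set - x | x in C] = [set 0] ].

Definition cone_le C x y : Prop := C (y - x).

Definition cone_itv C x y : set X := [set z | cone_le C x z /\ cone_le C z y].

Definition normal_cone C : Prop :=
  exists2 K : R, 0 < K &
    forall x y, cone_le C 0 x -> cone_le C x y -> `|x| <= K * `|y|.

(* The definitions [coneM], [conem] and [hilbert_dist] use real-valued [inf],
   [sup] and [ln], which return junk values outside their domains. If [C] is a
   closed pointed convex cone, [X] is nonzero and [y] is in [C°], then [coneM]
   and [conem] are a finite infimum and supremum; if [x] is in [C°] too, then
   [0 < conem C x y <= coneM C x y]. *)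
Definition coneM C x y : R := inf [set t : R | cone_le C x (t *: y)].

Definition conem C x y : R := sup [set t : R | cone_le C (t *: y) x].

Definition cone_osc C x y : R := coneM C x y - conem C x y.

Definition hilbert_dist C x y : R := ln (coneM C x y / conem C x y).

(* The topological dual is a set of functions, so that extreme points are taken
   in the vector space [X -> R^o] with pointwise operations. *)
Definition dual_space : set (X -> R^o) := [set mu | linear mu /\ continuous mu].

Definition dual_cone C : set (X -> R^o) :=
  [set mu | dual_space mu /\ forall x, C x -> 0 <= mu x].

Definition dual_slice C y : set (X -> R^o) :=
  [set mu | dual_cone C mu /\ mu y = 1].

End Cones.

Definition extreme_points {R : realType} {V : lmodType R} (A : set V) : set V :=
  [set e | A e /\ forall (a b : V) (t : R), A a -> A b -> 0 < t < 1 ->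
                    e = t *: a + (1 - t) *: b -> a = e /\ b = e].

(* Continuity of the derivative is for the operator norm. As [U] is open in all
   uses, ['d f x] depends only on the restriction of [f] to [U]. *)
Definition continuously_differentiable {R : realType} {X Y : normedModType R}
    (U : set X) (f : X -> Y) : Prop :=
  (forall x, U x -> differentiable f x) /\
  (forall x, U x -> forall e : R, 0 < e ->
     \forall y \near x, U y ->
       forall z, `|'d f y z - 'd f x z| <= e * `|z|).

(* Supremum of a set of nonnegative quantities: [0] on the empty set, where
   [ereal_sup] is [-oo]. *)
Definition nneg_sup {R : realType} (S : set (\bar R)) : \bar R :=
  if S == set0 then 0%E else ereal_sup S.

(* Main.v *)
From HB Require Import structures.
Require Import Defs.
From mathcomp Require Import ring lra.

Local Open Scope classical_set_scope.
Local Open Scope ring_scope.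

(** Write M(a/b) and m(a/b) for [coneM C a b] and [conem C a b]. Both sides of
    the identity measure how fast the functions
      t |-> ln nu(f(g(t))) - ln pi(f(g(t))),
    with [nu], [pi] in the dual cone and [g] a segment in [U], can grow: the left
    side measures it over whole segments, the right side at a single point.

    The link between the order and the dual cone is [extreme_dual_coneM]: for
    [b] interior, M(a/b) is attained as [mu a] at an extreme point [mu] of the
    slice [dual_slice C b]. Indeed M(./b) is a sublinear functional, the slice
    consists of the linear functionals below it, and Zorn's lemma applied to the
    sublinear functionals that cut out a face of the slice yields a linear one,
    which is an extreme point ([extreme_linear_below]). Applied to [- a], this
    also gives m(a/b). Hence for each [w] the supremum of [nu w - pi w] over
    extreme points is the oscillation M(w/b) - m(w/b), and it dominates
    [nu w - pi w] for all points of the slice.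

    The right side is at most the left one, [differential_le_of_ratio]: for [z]
    in [0, x] one has x <= x + s z <= (1 + s) x, so d_H(x + s z, x) <= ln (1 + s)
    <= s. On the other hand d_H(f(x + s z), f(x)) is at least
    ln nu(f(x + s z)) - ln pi(f(x + s z)), whose derivative at s = 0 is
    (nu - pi)(Df(x) z). If x + s z and x are proportional, so are their images,
    and the bound holds with both distances equal to 0.

    The left side is at most the right one, [ratio_le_of_differential]: choose
    [nu], [pi] attaining M(f(x)/f(y)) and m(f(x)/f(y)), and let
    g(t) = y + t (x - y). Then d_H(f(x), f(y)) is the increment over [0, 1] of
    ln nu(f(g(t))) - ln pi(f(g(t))), while with M = M(x/y) and m = m(x/y),
    d_H(x, y) = ln M - ln m is the increment of
    ln (1 + t (M - 1)) - ln (1 + t (m - 1)). The derivative of the former is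
    (nu' - pi')(Df(g(t)) (x - y)), where [nu'] and [pi'] are [nu] and [pi] scaled
    into the slice at f(g(t)). The derivative of the latter is the width of an
    interval [alpha, beta] such that alpha g(t) <= x - y <= beta g(t). Shifting
    x - y by alpha g(t) and dividing by beta - alpha gives an element of
    [0, g(t)], and the shift is harmless because Df(g) g is proportional to f(g)
    ([differential_radial]). So the derivatives compare, with the right side as
    constant, and the mean value theorem compares the increments. *)

(** * Extreme points of the set of functionals below a sublinear one *)

Section LinearMaps.
Context {R : realType} {V : lmodType R} (mu : V -> R) (mu_lin : linear (mu : V -> R^o)).

Let mu_of : {linear V -> R^o} :=
  HB.pack mu (GRing.isLinear.Build R V R^o *:%R mu mu_lin).

Lemma lin0 : mu 0 = 0. Proof. exact: (raddf0 mu_of). Qed.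

Lemma linN x : mu (- x) = - mu x. Proof. exact: (raddfN mu_of). Qed.

Lemma linD x y : mu (x + y) = mu x + mu y.
Proof. exact: (raddfD mu_of). Qed.

Lemma linB x y : mu (x - y) = mu x - mu y.
Proof. exact: (raddfB mu_of). Qed.

Lemma linZ (t : R) x : mu (t *: x) = t * mu x.
Proof. by have := mu_lin t x 0; rewrite !addr0 lin0 => ->; exact: addr0. Qed.

End LinearMaps.

Section Sublinear.
Context {R : realType} {V : lmodType R}.
Implicit Types (p q : V -> R) (x y z a : V).

Definition sublinear p : Prop :=
  (forall x y, p (x + y) <= p x + p y) /\
  (forall (t : R) x, 0 < t -> p (t *: x) <= t * p x).

Definition linear_below p : set (V -> R^o) :=
  [set mu : V -> R^o | linear mu /\ forall x, mu x <= p x].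

(** For [q <= p], [linear_below q] is a face of [linear_below p]. *)
Definition face_below p q : Prop :=
  forall mu1 mu2 (t : R), linear_below p mu1 -> linear_below p mu2 ->
    0 < t < 1 -> (forall x, t * mu1 x + (1 - t) * mu2 x <= q x) ->
    forall x, mu1 x <= q x /\ mu2 x <= q x.

Lemma sublinear0 p : sublinear p -> p 0 = 0.
Proof.
move=> [pD pZ]; have := pD 0 0; have := pZ 2^-1 0.
by rewrite scaler0 addr0 invr_gt0 ltr0n => /(_ isT); lra.
Qed.

Lemma sublinearZ p (t : R) x : sublinear p -> 0 <= t -> p (t *: x) = t * p x.
Proof.
move=> sp; rewrite le0r => /orP[/eqP->|t0].
  by rewrite scale0r mul0r sublinear0.
apply/le_anti; rewrite (proj2 sp)//= -ler_pdivlMl//.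
rewrite -{1}[x](@scalerK _ _ t) ?gt_eqF//.
by apply: (proj2 sp); rewrite invr_gt0.
Qed.

Lemma sublinearN p x : sublinear p -> - p (- x) <= p x.
Proof.
by move=> sp; have := proj1 sp x (- x); rewrite subrr sublinear0//; lra.
Qed.

Lemma linear_of_sublinear p :
  sublinear p -> (forall x, p (- x) = - p x) -> linear (p : V -> R^o).
Proof.
move=> sp pN; have pD x y : p (x + y) = p x + p y.
  apply/le_anti; rewrite (proj1 sp)/=.
  by have := proj1 sp (- x) (- y); rewrite -opprD !pN; lra.
move=> t x y; rewrite pD; congr (_ + _).
have [t0|/ltW t0] := leP 0 t; first exact: sublinearZ.
by rewrite -{1}[t]opprK scaleNr pN sublinearZ ?oppr_ge0// mulNr opprK.
Qed.

(** The linear functionals below [tilt q a] are those below [q] that take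
    the largest possible value, [q a], at [a]. *)
Definition tilt q a z : R :=
  inf [set q (z + s *: a) - s * q a | s in [set s : R | 0 <= s]].

Lemma tilt_lb q a z (s : R) : sublinear q -> 0 <= s ->
  tilt q a z <= q (z + s *: a) - s * q a.
Proof.
move=> sq s0; apply: ge_inf; last by exists s.
exists (- q (- z)) => _ [u /= u0 <-].
have := proj1 sq (z + u *: a) (- z).
by rewrite addrAC subrr add0r sublinearZ//; lra.
Qed.

Lemma tilt_glb q a z (c : R) :
  (forall s : R, 0 <= s -> c <= q (z + s *: a) - s * q a) -> c <= tilt q a z.
Proof.
move=> h; apply: lb_le_inf; last by move=> _ [s /= s0 <-]; exact: h.
by exists (q (z + 0 *: a) - 0 * q a), 0 => /=.
Qed.

Lemma tilt_le q a z : sublinear q -> tilt q a z <= q z.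
Proof.
by move=> sq; have := tilt_lb a z sq (lexx 0); rewrite scale0r addr0 mul0r subr0.
Qed.

Lemma tilt_oppl q a : sublinear q -> tilt q a (- a) <= - q a.
Proof.
move=> sq; have := tilt_lb a (- a) sq ler01.
by rewrite scale1r addNr mul1r sublinear0// sub0r.
Qed.

Lemma tilt_sublinear q a : sublinear q -> sublinear (tilt q a).
Proof.
move=> sq; split=> [x y|t x t0].
  rewrite -lerBlDl; apply: tilt_glb => s s0.
  rewrite lerBlDr -lerBlDl; apply: tilt_glb => u u0; rewrite lerBlDl.
  have := tilt_lb a (x + y) sq (addr_ge0 u0 s0).
  have := proj1 sq (x + u *: a) (y + s *: a).
  by rewrite addrACA -scalerDl mulrDl; lra.
rewrite -ler_pdivrMl//; apply: tilt_glb => s s0.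
have := tilt_lb a (t *: x) sq (mulr_ge0 (ltW t0) s0).
rewrite ler_pdivrMl// mulrBr mulrA -(sublinearZ _ sq (ltW t0)).
by rewrite scalerDr scalerA.
Qed.

(** The functionals of a face on which evaluation at [a] is maximal form a
    smaller face: a proper convex combination attains the maximum only if both of
    its terms do. *)
Lemma face_below_tilt p q a : sublinear q ->
  face_below p q -> face_below p (tilt q a).
Proof.
move=> sq fq mu1 mu2 t b1 b2 t01 h.
have qq z : mu1 z <= q z /\ mu2 z <= q z.
  by apply: fq t01 _ z => // x; apply: (le_trans (h x)); exact: tilt_le.
have [[l1 _] [l2 _]] := (b1, b2).
have [q1 q2] := qq a; have /andP[t0 t1] := t01.
have hNa : - (t * mu1 a + (1 - t) * mu2 a) <= - q a.
  apply: le_trans (tilt_oppl a sq); apply: le_trans (h _).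
  by rewrite (linN l1) (linN l2) !mulrN opprD.
have [e1 e2] : mu1 a = q a /\ mu2 a = q a by split; apply/le_anti; nra.
move=> x; split; apply: tilt_glb => s s0; have [] := qq (x + s *: a).
  by rewrite (linD l1) (linZ l1) e1; lra.
by rewrite (linD l2) (linZ l2) e2; lra.
Qed.

(** This combines the Hahn-Banach and Krein-Milman theorems in one use of Zorn's
    lemma. The set of sublinear [q <= tilt p a] such that [linear_below q] is a
    face of [linear_below p] is stable under infima of chains and under tilting.
    A minimal [q] thus equals all its tilts, and as [tilt q x (- x) <= - q x], it
    is linear. Its face is then the single point [q], an extreme point, and
    [q (- a) <= tilt p a (- a) <= - p a] forces [q a = p a]. *)
Lemma extreme_linear_below p a : sublinear p ->
  exists2 mu, extreme_points (linear_below p) mu & mu a = p a.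
Proof.
move=> sp.
pose good q := [/\ sublinear q, forall x, q x <= tilt p a x & face_below p q].
have good0 : good (tilt p a).
  split=> //; first exact: tilt_sublinear.
  by apply: face_below_tilt => // mu1 mu2 t b1 b2 _ _ x; split; [apply b1.2|apply b2.2].
pose T := {q | good q}.
pose r (q1 q2 : T) := `[< forall x, sval q2 x <= sval q1 x >].
have [] := @ZL_preorder T (exist _ _ good0) r.
- by move=> q; apply/asboolP.
- move=> q1 q2 q3 /asboolP h1 /asboolP h2; apply/asboolP => x.
  exact: le_trans (h1 x).
- move=> A totA; have [[q0 Aq0]|A0] := pselect (A !=set0); last first.
    by exists (exist _ _ good0) => s As; case: A0; exists s.
  pose Q x := inf [set sval q x | q in A].
  have Qlb (u : T) x : A u -> Q x <= sval u x.
    move=> Au; apply: ge_inf; last by exists u.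
    exists (- p (- x)) => _ [[v [sv vp fv]] /= _ <-].
    apply: le_trans (sublinearN _ sv); rewrite lerN2.
    by apply: (le_trans (vp _)); exact: tilt_le.
  have Qglb x (c : R) : (forall u : T, A u -> c <= sval u x) -> c <= Q x.
    move=> h; apply: lb_le_inf; last by move=> _ [q Aq <-]; exact: h.
    by exists (sval q0 x), q0.
  have goodQ : good Q.
    split.
    + split=> [x y|t x t0].
        rewrite -lerBlDl; apply: (Qglb) => q Aq.
        rewrite lerBlDr -lerBlDl; apply: Qglb => q' Aq'; rewrite lerBlDl [leRHS]addrC.
        (* of two members of the chain, the smaller one bounds both terms *)
        have [/asboolP qq'|/asboolP qq'] := totA _ _ Aq Aq'.
          apply: (le_trans (Qlb _ _ Aq')).
          have [[q'D _] _ _] := svalP q'.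
          by apply: (le_trans (q'D x y)); rewrite lerD2l.
        apply: (le_trans (Qlb _ _ Aq)).
        have [[qD _] _ _] := svalP q.
        by apply: (le_trans (qD x y)); rewrite lerD2r.
      rewrite -ler_pdivrMl//; apply: Qglb => q Aq.
      rewrite ler_pdivrMl//; apply: (le_trans (Qlb _ _ Aq)).
      by have [[_ +] _ _] := svalP q => /(_ t x t0).
    + move=> x; apply: (le_trans (Qlb _ x Aq0)).
      by have [_ + _] := svalP q0 => /(_ x).
    + move=> mu1 mu2 t b1 b2 t01 h x.
      have fq (q : T) : A q -> mu1 x <= sval q x /\ mu2 x <= sval q x.
        move=> Aq; have [_ _ fq] := svalP q; apply: fq t01 _ x => // y.
        by apply: (le_trans (h y)); exact: Qlb.
      by split; apply: Qglb => q /fq[].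
  by exists (exist _ Q goodQ) => q Aq; apply/asboolP => x; exact: Qlb.
- move=> [q [sq qp fq]] qmin.
  have tq b x : q x <= tilt q b x.
    have good' : good (tilt q b).
      split; first exact: tilt_sublinear.
      + by move=> y; apply: le_trans (qp y); exact: tilt_le.
      + exact: face_below_tilt.
    have /asboolP : r (exist _ _ (And3 sq qp fq)) (exist _ _ good').
      by apply/asboolP => y /=; exact: tilt_le.
    by move=> /asboolP/qmin/asboolP.
  have qN x : q (- x) = - q x.
    apply/le_anti/andP; split; first exact: le_trans (tq x _) (tilt_oppl x sq).
    by have := sublinearN x sq; lra.
  have linq := linear_of_sublinear sq qN.
  have qlep x : q x <= p x by apply: (le_trans (qp x)); exact: tilt_le.
  have max_q mu : linear_below p mu -> (forall x, mu x <= q x) -> mu = q.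
    move=> [lmu _] h; apply/funext => x; apply/le_anti; rewrite h/=.
    by have := h (- x); rewrite (linN lmu) qN; lra.
  exists q.
    split=> // mu1 mu2 t b1 b2 t01 e.
    have h x : mu1 x <= q x /\ mu2 x <= q x.
      by apply: (fq) t01 _ x => // y; rewrite e.
    by split; apply: max_q => // x; have [] := h x.
  apply/le_anti; rewrite qlep/=.
  have := le_trans (qp (- a)) (tilt_oppl a sp).
  by rewrite qN lerN2.
Qed.

End Sublinear.

(** * Hilbert's metric and the extreme points of the dual slices *)

Section Cone.
Context {R : realType} {X : normedModType R} (C : set X).
Hypotheses (X_neq0 : exists x : X, x != 0) (C_closed : closed C)
  (C_cone : pointed_convex_cone C).
Implicit Types (x y z b : X).

Lemma coneD x y : C x -> C y -> C (x + y).
Proof. by move=> Cx Cy; have [_ + _] := C_cone; apply; exists x => //; exists y. Qed.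

Lemma coneZ (t : R) x : 0 <= t -> C x -> C (t *: x).
Proof. by move=> t0 Cx; have [+ _ _] := C_cone; apply; [exact: t0|exists x]. Qed.

Lemma cone_pointed x : C x -> C (- x) -> x = 0.
Proof.
move=> Cx CNx; have [_ _ CNC] := C_cone.
suff : (C `&` [set - x | x in C]) x by rewrite CNC.
by split=> //; exists (- x) => //; rewrite opprK.
Qed.

Lemma cone_interior b : C° b -> C b.
Proof. exact: interior_subset. Qed.

Lemma cone0 b : C° b -> C 0.
Proof. by move=> /cone_interior/(coneZ (lexx 0)); rewrite scale0r. Qed.

(** An interior point [b] is an order unit, and the order-unit seminorm it defines
    is bounded by the norm: if the ball of radius r around [b] lies in the cone,
    then so does [b - x] for every [x] of norm r / 2. *)
Lemma interior_order_unit b : C° b ->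
  exists2 K : R, 0 < K & forall x, C ((K * `|x|) *: b - x).
Proof.
move=> Cb; have /nbhs_ballP[r /= r0 Br] : nbhs b C by [].
exists (2 / r) => [|x]; first by rewrite divr_gt0.
have [->|x0] := eqVneq x 0.
  by rewrite normr0 mulr0 scale0r subrr; exact: cone0 Cb.
have t0 : 0 < 2 / r * `|x| by rewrite !mulr_gt0 ?invr_gt0 ?normr_gt0.
rewrite -[x in _ - x](scalerKV (lt0r_neq0 t0)) -scalerBr.
apply: coneZ (ltW t0) _; apply: Br; rewrite -ball_normE /=.
rewrite opprB addrC subrK normrZ gtr0_norm ?invr_gt0//.
have xp : 0 < `|x| by rewrite normr_gt0.
have -> : (2 / r * `|x|)^-1 * `|x| = r / 2 by field; rewrite ?gt_eqF.
lra.
Qed.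

Lemma interior_cone_nopp b : C° b -> ~ C (- b).
Proof.
move=> Cb CNb; have [K K0 Kb] := interior_order_unit Cb.
have b0 : b = 0 by apply: cone_pointed => //; exact: cone_interior.
have [x /negP] := X_neq0; apply; apply/eqP; apply: cone_pointed.
  by have := Kb (- x); rewrite b0 scaler0 opprK add0r.
by have := Kb x; rewrite b0 scaler0 add0r.
Qed.

Lemma cone_interior_scale_ge0 b (t : R) : C° b -> C (t *: b) -> 0 <= t.
Proof.
move=> Cb Ctb; rewrite leNgt; apply/negP => t0.
apply: (interior_cone_nopp Cb).
have -> : - b = (- t)^-1 *: (t *: b).
  by rewrite scalerA invrN mulNr mulVf ?scaleN1r// lt_eqF.
by apply: coneZ => //; rewrite invr_ge0 oppr_ge0 ltW.
Qed.

Lemma cone_lim x b :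
  (forall e : R, 0 < e -> C (x + e *: b)) -> C x.
Proof.
move=> h.
have cv : (x + e *: b) @[e --> 0^'+] --> x + (0 : R) *: b.
  apply: cvg_at_right_filter; apply: cvgD; first exact: cvg_cst.
  exact: scalel_continuous.
rewrite scale0r addr0 in cv.
apply: (closed_cvg C C_closed _ _ cv).
by near=> e; apply: h; near: e; exact: nbhs_right_gt.
Unshelve. all: by end_near. Qed.

Section Slice.
Variables (b : X) (Cb : C° b).

(** The infimum defining [coneM] is over a closed half-line, so it is attained:
    order units bound it on both sides, and closedness of the cone passes to the
    limit. *)
Lemma coneM_spec x (t : R) : (coneM C x b <= t) <-> C (t *: b - x).
Proof.
have [K K0 Kb] := interior_order_unit Cb.
have hlb : has_lbound [set t : R | cone_le C x (t *: b)].
  exists (- (K * `|x|)) => s /= Cs.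
  rewrite -subr_ge0 opprK; apply: (cone_interior_scale_ge0 Cb).
  have := coneD Cs (Kb (- x)).
  by rewrite normrN opprK addrCA subrK -scalerDl addrC.
split=> [Mt|Ct]; last exact: ge_inf.
have up (s u : R) : C (s *: b - x) -> s <= u -> C (u *: b - x).
  move=> Cs su; rewrite -[u](subrK s) scalerDl -addrA.
  by apply: coneD => //; apply: coneZ; [rewrite subr_ge0|exact: cone_interior].
apply: (up) Mt; apply: (@cone_lim _ b) => e e0.
have hinf : has_inf [set t : R | cone_le C x (t *: b)].
  by split=> //; exists (K * `|x|); exact: Kb.
have [s Cs /ltW se] := inf_adherent e0 hinf.
by have := up _ _ Cs se; rewrite scalerDl addrAC.
Qed.

Lemma conemE x : conem C x b = - coneM C (- x) b.
Proof.
rewrite /conem /coneM /inf opprK; congr sup; apply/seteqP; split=> t /=.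
  move=> Ct; exists (- t); last by rewrite opprK.
  by move: Ct; rewrite /cone_le scaleNr opprK addrC.
by move=> [s Cs <-]; move: Cs; rewrite /cone_le scaleNr !opprK addrC.
Qed.

Lemma conem_spec x (t : R) : (t <= conem C x b) <-> C (x - t *: b).
Proof.
rewrite conemE lerNr; have := coneM_spec (- x) (- t).
by rewrite scaleNr opprK addrC.
Qed.

Lemma coneM_sublinear : sublinear (coneM C ^~ b).
Proof.
have up x : C (coneM C x b *: b - x) by exact/coneM_spec.
split=> [x y|t x t0]; apply/coneM_spec.
  by rewrite scalerDl opprD addrACA; exact: coneD.
by rewrite -scalerA -scalerBr; apply: coneZ => //; exact: ltW.
Qed.

Lemma conem_le_coneM x : conem C x b <= coneM C x b.
Proof. by rewrite conemE; exact: sublinearN coneM_sublinear. Qed.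

Lemma cone_osc_eq0 x : cone_osc C x b = 0 -> x = coneM C x b *: b.
Proof.
move=> /eqP; rewrite subr_eq0 => /eqP Mm; apply/eqP; rewrite -subr_eq0.
apply/eqP/cone_pointed; first by apply/conem_spec; rewrite -Mm.
by rewrite opprB; exact/coneM_spec.
Qed.

Lemma cone_osc_scale (t : R) : cone_osc C (t *: b) b = 0.
Proof.
apply/eqP; rewrite subr_eq0; apply/eqP/le_anti; rewrite conem_le_coneM andbT.
have C0 := cone0 Cb.
apply: (@le_trans _ _ t); last by apply/conem_spec; rewrite subrr.
by apply/coneM_spec; rewrite subrr.
Qed.

Lemma dual_slice_bounds (mu : X -> R^o) x : dual_slice C b mu ->
  conem C x b <= mu x <= coneM C x b.
Proof.
move=> [[[lmu _] mu0] mub].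
have h y : mu y <= coneM C y b :> R.
  have /(mu0 _) : C (coneM C y b *: b - y) by exact/coneM_spec.
  by rewrite (linB lmu) (linZ lmu) mub mulr1 subr_ge0.
by rewrite h andbT conemE lerNl; have := h (- x); rewrite (linN lmu).
Qed.

(** A linear functional below M(./b) is nonpositive on the opposite of the cone
    and takes values at most 1 and -1 at [b] and [- b], so it lies in the slice.
    It is continuous because [b] is an order unit. *)
Lemma dual_sliceE : dual_slice C b = linear_below (coneM C ^~ b).
Proof.
apply/seteqP; split=> mu.
  move=> Pmu; split; first by case: Pmu => [[[]]].
  by move=> x; have /andP[] := dual_slice_bounds x Pmu.
move=> [lmu leM]; have mu_ge0 x : C x -> 0 <= mu x :> R.
  move=> Cx; rewrite -oppr_le0 -(linN lmu); apply: (le_trans (leM _)).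
  by apply/coneM_spec; rewrite scale0r sub0r opprK.
split; last first.
  have C0 := cone0 Cb; apply/le_anti/andP; split.
    by apply: (le_trans (leM _)); apply/coneM_spec; rewrite scale1r subrr.
  rewrite -lerN2 -(linN lmu); apply: (le_trans (leM _)).
  by apply/coneM_spec; rewrite scaleN1r opprK addNr.
split=> //; split=> //.
have [K K0 Kb] := interior_order_unit Cb.
have bnd x : `|mu x : R| <= K * `|x|.
  rewrite ler_norml -lerNl -(linN lmu); apply/andP; split.
    by apply: (le_trans (leM _)); apply/coneM_spec; rewrite -(normrN x).
  by apply: (le_trans (leM _)); apply/coneM_spec.
pose mu' : {linear X -> R^o} :=
  HB.pack mu (GRing.isLinear.Build R X R^o *:%R mu lmu).
apply: (@bounded_linear_continuous R X R^o mu'); apply/linear_boundedP.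
exists K; split; first exact: num_real.
by move=> r Kr x; apply: (le_trans (bnd x)); rewrite ler_wpM2r// ltW.
Qed.

Lemma extreme_dual_coneM x :
  exists2 mu, extreme_points (dual_slice C b) mu & mu x = coneM C x b.
Proof. by rewrite dual_sliceE; exact: extreme_linear_below coneM_sublinear. Qed.

Lemma extreme_dual_conem x :
  exists2 mu, extreme_points (dual_slice C b) mu & mu x = conem C x b.
Proof.
have [mu ext muNx] := extreme_dual_coneM (- x); exists mu => //.
have [[[[lmu _] _] _] _] := ext.
by rewrite conemE -muNx (linN lmu) opprK.
Qed.

(** As [x] is an order unit, a multiple of it dominates [b], where [mu] is 1. *)
Lemma dual_slice_interior_gt0 (mu : X -> R^o) x :
  dual_slice C b mu -> C° x -> 0 < mu x :> R.
Proof.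
move=> [[[lmu _] mu0] mub] Cx; have [K K0 Kx] := interior_order_unit Cx.
have /(mu0 _) := Kx b.
rewrite (linB lmu) (linZ lmu) mub subr_ge0 => h.
suff Kb0 : 0 < K * `|b| by rewrite -(pmulr_rgt0 _ Kb0); exact: lt_le_trans h.
rewrite mulr_gt0// normr_gt0; apply/eqP => b0.
by move/eqP: mub; rewrite b0 (lin0 lmu) eq_sym oner_eq0.
Qed.

Lemma conem_gt0 x : C° x -> 0 < conem C x b.
Proof.
move=> Cx; have [mu [Pmu _] <-] := extreme_dual_conem x.
exact: dual_slice_interior_gt0.
Qed.

Lemma coneM_gt0 x : C° x -> 0 < coneM C x b.
Proof. by move=> Cx; apply: lt_le_trans (conem_gt0 Cx) (conem_le_coneM x). Qed.

Lemma hilbert_distE x : C° x ->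
  hilbert_dist C x b = ln (coneM C x b) - ln (conem C x b).
Proof.
move=> Cx; rewrite /hilbert_dist lnM ?posrE ?invr_gt0 ?coneM_gt0 ?conem_gt0//.
by rewrite lnV// posrE conem_gt0.
Qed.

Lemma hilbert_dist_ge0 x : C° x -> 0 <= hilbert_dist C x b.
Proof.
move=> Cx; rewrite hilbert_distE// subr_ge0.
by rewrite ler_ln ?posrE ?coneM_gt0 ?conem_gt0// conem_le_coneM.
Qed.

Lemma hilbert_dist_eq0 x : C° x ->
  (hilbert_dist C x b == 0) = (cone_osc C x b == 0).
Proof.
move=> Cx; rewrite hilbert_distE// !subr_eq0.
by rewrite (inj_in_eq (@ln_inj R)) ?posrE ?coneM_gt0 ?conem_gt0.
Qed.

End Slice.
End Cone.

(** * Differentiation along segments *)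

Lemma is_derive_dual_line {R : realType} {X Y : normedModType R}
    (mu : Y -> R^o) (f : X -> Y) (x v : X) (t : R) :
  dual_space mu -> differentiable f (x + t *: v) ->
  is_derive t (1 : R) (fun s : R => mu (f (x + s *: v)) : R)
            (mu ('d f (x + t *: v) v)).
Proof.
move=> [lmu cmu] df; set a := x + t *: v.
suff cv : h^-1 *: (((fun s : R => mu (f (x + s *: v)) : R) \o shift t) (h *: 1)
                  - mu (f a)) @[h --> 0^'] --> (mu ('d f a v) : R).
  by split; [apply/cvg_ex; exists (mu ('d f a v))|exact: cvg_lim cv].
have := diff_derivable (v := v) df; rewrite /derivable => dfv.
have {}dfv : h^-1 *: ((f \o shift a) (h *: v) - f a) @[h --> 0^'] --> 'd f a v.
  by rewrite -deriveE.
have /(_ _ _) cv := cvg_comp _ _ dfv (cmu ('d f a v)).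
apply: cvg_trans cv; apply: near_eq_cvg; near=> h => /=.
rewrite (linZ lmu) (linB lmu) /a; congr (_ * (mu (f _) - _)).
by rewrite scalerDl /GRing.scale /= mulr1 addrCA.
Unshelve. all: by end_near. Qed.

Lemma is_derive_ln {R : realType} (u : R -> R) (t du : R) :
  0 < u t -> is_derive t (1 : R) u du ->
  is_derive t (1 : R) (fun s => ln (u s)) (du / u t).
Proof.
move=> u0 hu; rewrite mulrC.
exact: (is_derive1_comp (is_derive1_ln u0) hu).
Qed.

Lemma is_derive_affine {R : realType} (k t : R) :
  is_derive t (1 : R) (fun s : R => 1 + s * k) k.
Proof.
have -> : (fun s : R => 1 + s * k) = cst 1 + k \*: (id : R -> R).
  by apply/funext => s; rewrite mulrC.
by apply: is_derive_eq; rewrite add0r scaler1.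
Qed.

Lemma segment_in_convex {R : realType} {X : normedModType R} (U : set X) x y
    (t : R) : convex_set U -> U x -> U y -> 0 <= t <= 1 -> U (y + t *: (x - y)).
Proof.
move=> cU /mem_set Ux /mem_set Uy /andP[t0 t1].
have := cU x y (Itv01 t0 t1) Ux Uy => /set_mem.
congr U; rewrite /conv /= /unstable.onem scalerBr scalerBl scale1r.
by rewrite addrCA addrC.
Qed.

Lemma is_derive_ge0_le {R : realType} (g dg : R -> R) (a b : R) : a < b ->
  (forall t, a <= t <= b -> is_derive t (1 : R) g (dg t)) ->
  (forall t, a <= t <= b -> 0 <= dg t) -> g a <= g b.
Proof.
move=> ab hg dg0.
have [||c] := MVT ab (f := g) (df := dg).
- by move=> t; rewrite in_itv /= => /andP[/ltW ta /ltW tb]; apply: hg; rewrite ta.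
- apply: continuous_in_subspaceT => t; rewrite inE /= in_itv /= => /hg h.
  apply: differentiable_continuous; apply/derivable1_diffP; exact: ex_derive.
rewrite in_itv /= => /andP[/ltW ac /ltW cb] e; rewrite -subr_ge0 e.
by rewrite mulr_ge0 ?subr_ge0 ?(ltW ab)// dg0// ac.
Qed.

(** * Bounding the derivative by the contraction ratio *)

Section Contraction.
Context {R : realType} {X : normedModType R} (C U : set X) (f : X -> X).
Hypotheses (X_neq0 : exists x : X, x != 0)
  (C_closed : closed C) (C_cone : pointed_convex_cone C).
Hypotheses (U_sub : U `<=` C°) (U_open : open U) (f_int : f @` U `<=` C°)
  (f_diff : forall x, U x -> differentiable f x)
  (f_osc : forall x y, U x -> U y ->
     cone_osc C x y = 0 -> cone_osc C (f x) (f y) = 0).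
Implicit Types (x y z v : X) (nu pi : X -> R^o).

Let fC x : U x -> C° (f x).
Proof. by move=> Ux; apply: f_int; exists x. Qed.

(** Hilbert's distance is the logarithmic oscillation over the slice, since the
    values at [a] of the functionals of the slice lie in [m(a/b), M(a/b)]. *)
Lemma dual_slice_ln_le a b nu pi : C° a -> C° b ->
  dual_slice C b nu -> dual_slice C b pi ->
  ln (nu a : R) - ln (pi a : R) <= hilbert_dist C a b.
Proof.
move=> Ca Cb Pnu Ppi; rewrite hilbert_distE//.
have nua := dual_slice_interior_gt0 C_cone Pnu Ca.
have pia := dual_slice_interior_gt0 C_cone Ppi Ca.
have /andP[_ nuM] := dual_slice_bounds X_neq0 C_closed C_cone Cb a Pnu.
have /andP[mpi _] := dual_slice_bounds X_neq0 C_closed C_cone Cb a Ppi.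
by rewrite lerB// ler_ln ?posrE// ?coneM_gt0 ?conem_gt0.
Qed.

Lemma near0_line x v : U x -> \forall s \near (0 : R), U (x + s *: v).
Proof.
move=> Ux; have cv : (x + s *: v) @[s --> (0 : R)] --> x + (0 : R) *: v.
  by apply: cvgD; [exact: cvg_cst|exact: scalel_continuous].
by apply: cv; apply: open_nbhs_nbhs; split; rewrite ?scale0r ?addr0.
Qed.

(** Points on the ray through [x] are sent to the ray through [f x], so [nu] and
    [pi], which agree at [f x], agree along the image of the ray of [x] and have
    the same derivative there. *)
Lemma differential_radial x nu pi : U x ->
  dual_slice C (f x) nu -> dual_slice C (f x) pi ->
  nu ('d f x x) = pi ('d f x x).
Proof.
move=> Ux Pnu Ppi; have [[[lnu _] _] nux] := Pnu; have [[[lpi _] _] pix] := Ppi.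
have Ux0 : U (x + (0 : R) *: x) by rewrite scale0r addr0.
have dnu := is_derive_dual_line Pnu.1.1 (f_diff Ux0).
have dpi := is_derive_dual_line Ppi.1.1 (f_diff Ux0).
rewrite scale0r addr0 in dnu dpi.
have [_ valB] := is_deriveB dnu dpi.
have d0 := is_derive_cst (0 : R) (0 : R) (1 : R).
have [_] : is_derive (0 : R) (1 : R)
    ((fun s : R => nu (f (x + s *: x)) : R) -
     (fun s : R => pi (f (x + s *: x)) : R)) 0.
  apply: near_eq_is_derive d0; near=> s => /=.
  have Us : U (x + s *: x) by near: s; exact: near0_line.
  have osc0 : cone_osc C (x + s *: x) x = 0.
    rewrite -{1}[x]scale1r -scalerDl; apply: cone_osc_scale => //; exact: U_sub.
  rewrite /cst !fctE.
  rewrite (cone_osc_eq0 X_neq0 C_closed C_cone (fC Ux) (f_osc Us Ux osc0)).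
  by rewrite (linZ lnu) (linZ lpi) nux pix subrr.
by rewrite valB => /eqP; rewrite subr_eq0 => /eqP.
Unshelve. all: by end_near. Qed.

(** The displacement from [x] to [x + s *: z] has Hilbert length at most [s], and
    the logarithmic oscillation of its image grows at rate
    [nu ('d f x z) - pi ('d f x z)]; compare both as [s] tends to 0. *)
Lemma differential_le_of_ratio (S : R) x z nu pi : 0 <= S ->
  (forall x y, U x -> U y -> hilbert_dist C x y != 0 ->
    hilbert_dist C (f x) (f y) <= S * hilbert_dist C x y) ->
  U x -> dual_slice C (f x) nu -> dual_slice C (f x) pi ->
  cone_itv C 0 x z -> nu ('d f x z) - pi ('d f x z) <= S :> R.
Proof.
move=> S0 hS Ux Pnu Ppi [C0z Czx].
have [_ nux] := Pnu; have [_ pix] := Ppi.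
have Ux0 : U (x + (0 : R) *: z) by rewrite scale0r addr0.
have dnu := is_derive_dual_line Pnu.1.1 (f_diff Ux0).
have dpi := is_derive_dual_line Ppi.1.1 (f_diff Ux0).
rewrite scale0r addr0 in dnu dpi.
have pos (mu : X -> R^o) : dual_slice C (f x) mu -> 0 < mu (f (x + (0 : R) *: z)) :> R.
  by move=> Pmu; rewrite scale0r addr0 Pmu.2.
have dF := is_deriveB (is_derive_ln (pos _ Pnu) dnu) (is_derive_ln (pos _ Ppi) dpi).
set F := (X in is_derive _ _ X _) in dF.
have F0 : F 0 = 0.
  by rewrite /F !fctE scale0r addr0 nux pix subrr.
have Fle (s : R) : 0 < s -> U (x + s *: z) -> F s <= S * s.
  move=> s0 Us.
  have Cx := U_sub Ux; have Cs := U_sub Us.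
  have -> : F s = ln (nu (f (x + s *: z)) : R) - ln (pi (f (x + s *: z)) : R) by [].
  apply: le_trans (dual_slice_ln_le (fC Us) (fC Ux) Pnu Ppi) _.
  have [/eqP d0|d0] := eqVneq (hilbert_dist C (x + s *: z) x) 0.
    rewrite hilbert_dist_eq0// in d0.
    have /eqP : cone_osc C (f (x + s *: z)) (f x) = 0 by apply: f_osc => //; exact/eqP.
    rewrite -hilbert_dist_eq0//; [|exact: fC|exact: fC].
    by move=> /eqP ->; rewrite mulr_ge0// ltW.
  apply: (le_trans (hS _ _ Us Ux d0)); apply: ler_wpM2l => //.
  (* x <= x + s z <= (1 + s) x *)
  have M1 : coneM C (x + s *: z) x <= 1 + s.
    apply/coneM_spec => //; rewrite scalerDl scale1r opprD addrACA subrr add0r.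
    by rewrite -scalerBr; apply: coneZ => //; exact: ltW.
  have m1 : 1 <= conem C (x + s *: z) x.
    apply/conem_spec => //; rewrite scale1r addrAC subrr add0r.
    apply: coneZ => //; first exact: ltW.
    by move: C0z; rewrite /cone_le subr0.
  rewrite hilbert_distE//.
  have l1 : ln (coneM C (x + s *: z) x) <= s.
    apply: (@le_trans _ _ (ln (1 + s))); last by apply: le_ln1Dx; lra.
    by rewrite ler_ln ?posrE ?coneM_gt0//; lra.
  have l2 : 0 <= ln (conem C (x + s *: z) x) by exact: ln_ge0.
  by lra.
have [dvF valF] := dF.
have : (F s / s) @[s --> (0 : R)^'+] --> 'D_1 F 0.
  apply: cvg_dnbhs_at_right; apply: cvg_trans dvF; apply: near_eq_cvg.
  near=> h => /=; rewrite F0 subr0 addr0 /GRing.scale /= mulr1.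
  by rewrite mulrC.
rewrite valF scale0r addr0 nux pix !divr1 => /cvgr_to_le; apply.
near=> s; have s0 : 0 < s by near: s; exact: nbhs_right_gt.
rewrite ler_pdivrMr//; apply: Fle => //; near: s.
exact: cvg_within (near0_line z Ux).
Unshelve. all: by end_near. Qed.

(** * Bounding the contraction ratio by the derivative *)

Section UpperBound.
Variable L : R.
Hypothesis hL : forall x nu pi z, U x ->
  extreme_points (dual_slice C (f x)) nu ->
  extreme_points (dual_slice C (f x)) pi ->
  cone_itv C 0 x z -> nu ('d f x z) - pi ('d f x z) <= L :> R.

(** The vector [(v - alpha *: x) / (beta - alpha)] lies in the order interval from
    0 to [x], and by [differential_radial] the multiple of [x] that is subtracted
    from [v] does not contribute. The bound [hL] passes from extreme points to the
    whole slice since extreme points attain the oscillation. *)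
Lemma differential_itv_le x nu pi v (alpha beta : R) : U x ->
  dual_slice C (f x) nu -> dual_slice C (f x) pi ->
  alpha < beta -> cone_le C (alpha *: x) v -> cone_le C v (beta *: x) ->
  nu ('d f x v) - pi ('d f x v) <= L * (beta - alpha) :> R.
Proof.
move=> Ux Pnu Ppi ab av vb; set z := (beta - alpha)^-1 *: (v - alpha *: x).
have c0 : 0 < beta - alpha by rewrite subr_gt0.
have zI : cone_itv C 0 x z.
  split; rewrite /cone_le.
    by rewrite subr0; apply: coneZ => //; rewrite invr_ge0 ltW.
  have -> : x - z = (beta - alpha)^-1 *: (beta *: x - v).
    rewrite -{1}(scalerK (lt0r_neq0 c0) x) -scalerBr; congr (_ *: _).
    by rewrite scalerBl opprB addrA subrK.
  by apply: coneZ => //; rewrite invr_ge0 ltW.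
have -> : v = (beta - alpha) *: z + alpha *: x.
  by rewrite scalerKV ?lt0r_neq0// subrK.
move: z zI => z zI.
have [[[lnu _] _] _] := Pnu; have [[[lpi _] _] _] := Ppi.
rewrite linearD !linearZ (linD lnu) (linD lpi) !(linZ lnu) !(linZ lpi).
rewrite (differential_radial Ux Pnu Ppi) opprD addrACA subrr addr0 -mulrBr mulrC ler_pM2r//.
have [nu' Enu nuM] := extreme_dual_coneM X_neq0 C_closed C_cone (fC Ux) ('d f x z).
have [pi' Epi pim] := extreme_dual_conem X_neq0 C_closed C_cone (fC Ux) ('d f x z).
apply: le_trans (hL Ux Enu Epi zI); rewrite nuM pim.
have /andP[_ nuM'] :=
  dual_slice_bounds X_neq0 C_closed C_cone (fC Ux) ('d f x z) Pnu.
have /andP[mpi' _] :=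
  dual_slice_bounds X_neq0 C_closed C_cone (fC Ux) ('d f x z) Ppi.
exact: lerB.
Qed.

(** Along the segment from [y] to [x], [L] times the logarithmic growth of the
    bounds of the order interval minus that of the extremal functionals of the
    image is nondecreasing: [differential_itv_le] makes its derivative
    nonnegative. Its increment is the asserted difference. *)
Lemma ratio_le_of_differential x y : convex_set U -> U x -> U y ->
  hilbert_dist C x y != 0 ->
  hilbert_dist C (f x) (f y) <= L * hilbert_dist C x y.
Proof.
move=> cU Ux Uy dxy.
have Cx := U_sub Ux; have Cy := U_sub Uy; have Cfx := fC Ux; have Cfy := fC Uy.
rewrite hilbert_dist_eq0// subr_eq0 in dxy.
set M := coneM C x y in dxy; set m := conem C x y in dxy.
have mM : m < M.
  by rewrite lt_neqAle eq_sym dxy; exact: conem_le_coneM.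
have m0 : 0 < m by exact: conem_gt0.
have M0 : 0 < M by exact: lt_trans mM.
have [nu [Pnu _] nuM] := extreme_dual_coneM X_neq0 C_closed C_cone Cfy (f x).
have [pi [Ppi _] pim] := extreme_dual_conem X_neq0 C_closed C_cone Cfy (f x).
have [[[lnu cnu] nu0] nuy] := Pnu; have [[[lpi cpi] pi0] piy] := Ppi.
pose g (t : R) := y + t *: (x - y).
have Ug t : 0 <= t <= 1 -> U (g t) by exact: segment_in_convex.
have pos (k t : R) : 0 < k -> 0 <= t <= 1 -> 0 < 1 + t * (k - 1).
  by move=> k0 /andP[t0 t1]; nra.
pose G (t : R) := L * (ln (1 + t * (M - 1)) - ln (1 + t * (m - 1)))
  - (ln (nu (f (g t)) : R) - ln (pi (f (g t)) : R)).
pose dG (t : R) := L * ((M - 1) / (1 + t * (M - 1)) - (m - 1) / (1 + t * (m - 1)))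
  - ((nu ('d f (g t) (x - y)) : R) / (nu (f (g t)) : R)
     - (pi ('d f (g t) (x - y)) : R) / (pi (f (g t)) : R)).
have gt0 mu t : dual_slice C (f y) mu -> 0 <= t <= 1 -> 0 < mu (f (g t)) :> R.
  by move=> Pmu t01; apply: dual_slice_interior_gt0 Pmu _ => //; exact/fC/Ug.
suff : G 0 <= G 1.
  rewrite /G /g !mul0r !addr0 !mul1r scale0r addr0 scale1r.
  rewrite [y + _]addrC subrK nuy piy nuM pim !ln1 !subrr mulr0 subrr.
  rewrite [1 + (M - 1)]addrC [1 + (m - 1)]addrC !subrK !hilbert_distE//.
  by rewrite subr_ge0.
apply: (@is_derive_ge0_le R G dG) => // t t01.
  have dln (k : R) : 0 < k -> is_derive t (1 : R)
      (fun s : R => ln (1 + s * (k - 1))) ((k - 1) / (1 + t * (k - 1))).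
    move=> k0; apply: (is_derive_ln (u := fun s : R => 1 + s * (k - 1))).
      exact: pos.
    exact: is_derive_affine.
  have dmu mu : dual_slice C (f y) mu -> is_derive t (1 : R)
      (fun s : R => ln (mu (f (g s)) : R))
      ((mu ('d f (g t) (x - y)) : R) / (mu (f (g t)) : R)).
    move=> Pmu; apply: (is_derive_ln (u := fun s : R => mu (f (g s)) : R)).
      exact: gt0.
    exact: (is_derive_dual_line Pmu.1.1 (f_diff (Ug _ t01))).
  exact: (is_deriveB (is_deriveZ L (is_deriveB (dln M M0) (dln m m0)))
                     (is_deriveB (dmu _ Pnu) (dmu _ Ppi))).
(* rescaling moves a functional of the slice at [f y] to that at [f (g t)] *)
have normalize mu : dual_slice C (f y) mu ->
    dual_slice C (f (g t)) (fun z => (mu (f (g t)) : R)^-1 * (mu z : R) : R^o).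
  move=> Pmu; have [[[lmu cmu] mu0] _] := Pmu.
  split; last by rewrite mulVf// gt_eqF// gt0.
  split; last first.
    by move=> z Cz; rewrite mulr_ge0 ?mu0// invr_ge0 ltW// gt0.
  split; last by move=> z; apply: cvgMr; exact: cmu.
  by move=> k u w; rewrite lmu mulrDr /GRing.scale /= mulrCA.
have Mt := pos _ _ M0 t01; have mt := pos _ _ m0 t01.
have /andP[t0 t1] := t01.
(* [k = M] and [k = m] give the upper and lower order bounds of [x - y] by
   multiples of [g t] *)
have gE k : 0 < k -> ((k - 1) / (1 + t * (k - 1))) *: g t - (x - y) =
    (1 + t * (k - 1))^-1 *: (k *: y - x).
  move=> k0; have kt := lt0r_neq0 (pos _ _ k0 t01).
  have -> : k *: y - x = (k - 1) *: y - (x - y).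
    by rewrite scalerBl scale1r opprB addrA subrK.
  rewrite /g; move: (x - y) => w; rewrite scalerDr scalerBr !scalerA.
  rewrite [_^-1 * _]mulrC -addrA; congr (_ + _).
  by rewrite -{2}[w]scale1r -scalerBl -scaleNr; congr (_ *: _); field.
have := @differential_itv_le (g t) _ _ (x - y)
  ((m - 1) / (1 + t * (m - 1))) ((M - 1) / (1 + t * (M - 1)))
  (Ug _ t01) (normalize _ Pnu) (normalize _ Ppi).
rewrite /dG subr_ge0 ![_ / (_ (f (g t)) : R)]mulrC; apply.
- rewrite ltr_pdivrMr// mulrAC ltr_pdivlMr//; nra.
- rewrite /cone_le -opprB gE// -scalerN opprB.
  by apply: coneZ; [|rewrite invr_ge0 ltW|exact/conem_spec].
- rewrite /cone_le gE//.
  by apply: coneZ; [|rewrite invr_ge0 ltW|exact/coneM_spec].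
Qed.

End UpperBound.
End Contraction.

Theorem corollary3p9 (R : realType) (X : completeNormedModType R)
    (C U : set X) (f : X -> X)
    (X_neq0 : exists x : X, x != 0)
    (C_closed : closed C) (C_cone : pointed_convex_cone C)
    (C_normal : normal_cone C) (C_int : C° !=set0)
    (U_neq0 : U !=set0) (U_sub : U `<=` C°) (U_convex : convex_set U)
    (U_open : open U)
    (U_scale : forall t : R, 0 < t -> [set t *: x | x in U] `<=` U)
    (f_int : f @` U `<=` C°)
    (f_C1 : continuously_differentiable U f)
    (f_osc : forall x y, U x -> U y ->
       cone_osc C x y = 0 -> cone_osc C (f x) (f y) = 0) :
  nneg_sup [set (hilbert_dist C (f p.1) (f p.2)
                   / hilbert_dist C p.1 p.2)%:E
           | p in [set p : X * X |
                [/\ U p.1, U p.2 & hilbert_dist C p.1 p.2 != 0]]] =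
  ereal_sup [set
    ereal_sup [set
      ereal_sup [set ((nu - pi) ('d f x z))%:E | z in cone_itv C 0 x]
    | nu in extreme_points (dual_slice C (f x))
    & pi in extreme_points (dual_slice C (f x))]
  | x in U].
Proof.
have f_diff := f_C1.1.
have f_C x : U x -> C° (f x) by move=> Ux; apply: f_int; exists x.
have dist_ge0 x y : C° x -> C° y -> 0 <= hilbert_dist C x y.
  by move=> Cx Cy; exact: hilbert_dist_ge0.
set A := [set _ | _ in _]; set B := ereal_sup _.
have B_ub x nu pi z : U x -> extreme_points (dual_slice C (f x)) nu ->
    extreme_points (dual_slice C (f x)) pi -> cone_itv C 0 x z ->
    ((nu ('d f x z) - pi ('d f x z) : R)%:E <= B)%E.
  move=> Ux Enu Epi zI; apply: le_ereal_sup_tmp.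
  eexists; first by exists x.
  apply: le_ereal_sup_tmp; eexists; first by exists nu => //; exists pi.
  by apply: ereal_sup_ubound; exists z.
have B_ge0 : (0 <= B)%E.
  have [u Uu] := U_neq0.
  have [nu Enu _] := extreme_dual_coneM X_neq0 C_closed C_cone (f_C _ Uu) 0.
  have := B_ub u nu nu 0 Uu Enu Enu; rewrite subrr; apply.
  split; rewrite /cone_le ?subr0; first exact: cone0 (U_sub _ Uu).
  by apply: cone_interior; exact: U_sub.
have A_ge0 : (0 <= nneg_sup A)%E.
  rewrite /nneg_sup; case: ifPn => // /set0P[_ [p Ap _]].
  apply: le_ereal_sup_tmp; eexists; first by exists p.
  have [U1 U2 _] := Ap.
  by rewrite lee_fin divr_ge0// dist_ge0//; [exact: f_C|exact: f_C|exact: U_sub|exact: U_sub].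
apply/le_anti/andP; split.
- rewrite {1}/nneg_sup; case: ifPn => // _.
  case: B B_ge0 B_ub => [L| |] // L0 hL; last by rewrite leey.
  apply: ge_ereal_sup => _ [p [U1 U2 d12] <-]; rewrite lee_fin.
  have d0 : 0 < hilbert_dist C p.1 p.2.
    by rewrite lt_neqAle eq_sym d12 dist_ge0//; exact: U_sub.
  rewrite ler_pdivrMr//; exact: (@ratio_le_of_differential R X C U f).
- apply: ge_ereal_sup => _ [x Ux <-].
  apply: ge_ereal_sup => _ [nu [Pnu _] [pi [Ppi _] <-]].
  apply: ge_ereal_sup => _ [z zI <-].
  have : forall p, U p.1 -> U p.2 -> hilbert_dist C p.1 p.2 != 0 ->
      ((hilbert_dist C (f p.1) (f p.2) / hilbert_dist C p.1 p.2)%:E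
       <= nneg_sup A)%E.
    move=> p U1 U2 d12.
    have Ap : A (hilbert_dist C (f p.1) (f p.2) / hilbert_dist C p.1 p.2)%:E.
      by exists p.
    have A0 : A != set0 by apply/set0P; eexists; exact: Ap.
    by rewrite /nneg_sup (negbTE A0); exact: ereal_sup_ubound.
  case: nneg_sup A_ge0 => [S| |] //; last by move=> _ _; rewrite leey.
  rewrite lee_fin => S0 hS; rewrite lee_fin.
  apply: (@differential_le_of_ratio R X C U f) => // a b Ua Ub dab.
  have d0 : 0 < hilbert_dist C a b.
    by rewrite lt_neqAle eq_sym dab dist_ge0//; exact: U_sub.
  by rewrite -ler_pdivrMr// -lee_fin; exact: (hS (a, b)).
Qed.
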